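(* Let $\Omega$ be a finite set of size $n$ and $1\le r\le n$. Let $\{\mathcal{H}_1,\dots,\mathcal{H}_s\}$ be the set of all minimal domination completions of $\mathcal{U}_{r,\Omega}$ (the minimal elements of $(\mathrm{Dom}(r,\Omega),\leqslant)$). Then $\mathcal{U}_{r,\Omega}=\mathcal{H}_1\sqcap\cdots\sqcap\mathcal{H}_s$.
   Context: Graphs are finite, simple, undirected; $\mathcal{D}(G)$ is the family of inclusion-minimal dominating sets of $G$ (a dominating set is $D\subseteq V(G)$ such that every vertex outside $D$ has a neighbour in $D$). A hypergraph on $\Omega$ is a nonempty family of nonempty subsets of $\Omega$, none a proper subset of another; it has ground set $\Omega$ if the union of its members is $\Omega$. A domination hypergraph is one of the form $\mathcal{D}(G)$ for a graph $G$. $\mathcal{U}_{r,\Omega}=\{A\subseteq\Omega:|A|=r\}$. For hypergraphs $\mathcal{H}_1,\mathcal{H}_2$ on $\Omega$, $\mathcal{H}_1\leqslant\mathcal{H}_2$ means: for every $A_1\in\mathcal{H}_1$ there is $A_2\in\mathcal{H}_2$ with $A_2\subseteq A_1$ (a partial order). $\mathrm{Dom}(r,\Omega)$ is the set of domination hypergraphs $\mathcal{H}$ with ground set $\Omega$ with $\mathcal{U}_{r,\Omega}\leqslant\mathcal{H}$. For hypergraphs $\mathcal{H}_1,\dots,\mathcal{H}_\ell$ on $\Omega$, $\mathcal{H}_1\sqcap\cdots\sqcap\mathcal{H}_\ell$ is the family of inclusion-minimal sets among $\{A_1\cup\cdots\cup A_\ell: A_i\in\mathcal{H}_i\}$. 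*)

(* Defs.v *)
From mathcomp Require Import all_boot.

Set Implicit Arguments.
Unset Strict Implicit.
Unset Printing Implicit Defensive.

Section Domination.

Variable T : finType.
Implicit Types (V D A B : {set T}) (E H : {set {set T}}).

(* A simple graph (V, E) with vertices in T; an edge is a 2-element subset of
   the vertex set V. *)
Definition is_graph V E : bool :=
  [forall e in E, (e \subset V) && (#|e| == 2)].

Definition dominating V E D : bool :=
  (D \subset V) && [forall v in V :\: D, exists u in D, [set u; v] \in E].

Definition min_dominating_sets V E : {set {set T}} :=
  [set D | minset (dominating V E) D].

Definition is_hypergraph H : bool :=
  [&& H != set0, set0 \notin H & [forall A in H, forall B in H, ~~ (A \proper B)]].

Definition has_ground_set H (Omega : {set T}) : bool := cover H == Omega.

(* The vertex set is not fixed in advance to be the whole of T. *)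
Definition is_domination_hypergraph H : bool :=
  is_hypergraph H &&
  [exists V : {set T}, exists E : {set {set T}},
     is_graph V E && (H == min_dominating_sets V E)].

Definition hle H1 H2 : bool :=
  [forall A1 in H1, exists A2 in H2, A2 \subset A1].

End Domination.

Definition uniform (r : nat) (T : finType) : {set {set T}} :=
  [set A : {set T} | #|A| == r].

Definition Dom (r : nat) (T : finType) : {set {set {set T}}} :=
  [set H | [&& is_domination_hypergraph H, has_ground_set H [set: T]
             & hle (uniform r T) H]].

Definition min_completions (r : nat) (T : finType) : {set {set {set T}}} :=
  [set H in Dom r T | [forall H' in Dom r T, hle H' H ==> (H' == H)]].

(* The sets A_1 :|: ... :|: A_l with A_i \in F i, the index i ranging over P;
   f is the choice of the A_i (its values outside P are irrelevant). *)
Definition is_choice_union (T I : finType) (P : {set I}) (F : I -> {set {set T}})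
    (A : {set T}) : bool :=
  [exists f : {ffun I -> {set T}},
     [forall i in P, f i \in F i] && (A == \bigcup_(i in P) f i)].

Definition sqcap (T I : finType) (P : {set I}) (F : I -> {set {set T}}) :
    {set {set T}} :=
  [set A | minset (is_choice_union P F) A].

(* Main.v *)
Require Import Defs.
From mathcomp Require Import all_boot.

Set Implicit Arguments.
Unset Strict Implicit.
Unset Printing Implicit Defensive.

(** Every [r]-set contains a member of each completion, so it suffices that no
    union of a choice of members has fewer than [r] elements, i.e. that every
    [B] with [#|B| < r] is avoided by some minimal completion (contains none of
    its members).  Pick [v] outside [B] and let [G] be the complete graph minus
    the edges from [v] to [B]: in [G] every [r]-set is dominating while [B] does
    not dominate [v].  Avoiding [B] is inherited downwards along [hle], hence by
    a minimal completion below the minimal dominating sets of [G]. *)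

Section HypergraphOrder.

Variable T : finType.
Implicit Types (A B : {set T}) (H : {set {set T}}).

Lemma hleP H1 H2 :
  reflect (forall A, A \in H1 -> exists2 B, B \in H2 & B \subset A)
          (hle H1 H2).
Proof.
apply: (iffP forall_inP) => h A /h; first by move/exists_inP.
by move=> hB; apply/exists_inP.
Qed.

Lemma hle_refl H : hle H H.
Proof. by apply/hleP => A hA; exists A. Qed.

Lemma hle_trans H2 H1 H3 : hle H1 H2 -> hle H2 H3 -> hle H1 H3.
Proof.
move=> /hleP h12 /hleP h23; apply/hleP => A /h12 [B /h23 [C hC sCB] sBA].
by exists C => //; apply: subset_trans sBA.
Qed.

(** Going from [A] in [H1] down to [B] in [H2] and then to [C] in [H1], the antichain property
    forces [C = A], hence [B = A]. *)
Lemma hle_sub H1 H2 :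
  is_hypergraph H1 -> hle H1 H2 -> hle H2 H1 -> H1 \subset H2.
Proof.
case/and3P=> _ _ /forall_inP anti /hleP h12 /hleP h21.
apply/subsetP => A hA; have [B hB sBA] := h12 A hA.
have [C hC sCB] := h21 B hB; have sCA := subset_trans sCB sBA.
have /forall_inP/(_ A hA) := anti C hC.
rewrite properE sCA negbK => sAC.
suff -> : A = B by [].
by apply/eqP; rewrite eqEsubset sBA (subset_trans sAC sCB).
Qed.

Lemma hle_anti H1 H2 :
  is_hypergraph H1 -> is_hypergraph H2 -> hle H1 H2 -> hle H2 H1 -> H1 = H2.
Proof. by move=> *; apply/eqP; rewrite eqEsubset !hle_sub. Qed.

(** This turns [hle] into plain inclusion, so that the cardinality of the closure can serve as a
    measure for descending along the order. *)
Definition up_closure H : {set {set T}} :=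
  [set A : {set T} | [exists B in H, B \subset A]].

Lemma hle_up_closure H1 H2 :
  hle H1 H2 = (up_closure H1 \subset up_closure H2).
Proof.
apply/hleP/subsetP => [h A | h A hA].
  rewrite !inE => /exists_inP[B /h [C hC sCB] sBA].
  by apply/exists_inP; exists C => //; apply: subset_trans sBA.
have: A \in up_closure H2.
  by apply: h; rewrite inE; apply/exists_inP; exists A.
by rewrite inE => /exists_inP.
Qed.

Lemma Dom_hypergraph r H : H \in Dom r T -> is_hypergraph H.
Proof. by rewrite inE => /and3P[/andP[]]. Qed.

(** Among the completions below [H], take one whose up-closure is smallest. Any completion below it
    has the same up-closure, so antisymmetry identifies the two. *)
Lemma min_completion_below r H :
  H \in Dom r T -> exists2 H', H' \in min_completions r T & hle H' H.
Proof.
move=> hH; pose P H' := (H' \in Dom r T) && hle H' H.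
have P0 : P H by rewrite /P hH hle_refl.
case: (@arg_minnP _ H P (fun H' => #|up_closure H'|) P0) => M.
case/andP=> hM leMH minM; exists M => //.
rewrite inE hM; apply/forall_inP => H' hH'; apply/implyP => leH'M.
have := minM H'; rewrite /P hH' (hle_trans leH'M leMH) => /(_ isT) leMH'.
apply/eqP/hle_anti; rewrite ?(Dom_hypergraph hH') ?(Dom_hypergraph hM) //.
have /eqP eq_up : up_closure H' == up_closure M.
  by rewrite eqEcard -hle_up_closure leH'M.
by rewrite hle_up_closure eq_up.
Qed.

End HypergraphOrder.

Section MinimalDominatingSets.

Variables (T : finType) (E : {set {set T}}).
Implicit Types (D : {set T}).

Lemma dominatingTP D :
  reflect (forall v, v \notin D -> exists2 u, u \in D & [set u; v] \in E)
          (dominating [set: T] E D).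
Proof.
rewrite /dominating subsetT.
apply: (iffP forall_inP) => h v hv; last first.
  by apply/exists_inP/h; move: hv; rewrite !inE andbT.
by apply/exists_inP/h; rewrite !inE hv.
Qed.

Lemma dominatingTT : dominating [set: T] E [set: T].
Proof. by apply/dominatingTP => v; rewrite inE. Qed.

Lemma min_dominating_sub D :
  dominating [set: T] E D ->
  exists2 D', D' \in min_dominating_sets [set: T] E & D' \subset D.
Proof. by case/minset_exists => D' minD' sD'D; exists D'; rewrite ?inE. Qed.

(** The vertex [x] keeps the empty set from dominating; over an empty vertex set it would be a
    member. *)
Lemma min_dominating_hypergraph (x : T) :
  is_hypergraph (min_dominating_sets [set: T] E).
Proof.
apply/and3P; split.
- have [D hD _] := min_dominating_sub dominatingTT.
  by apply/set0Pn; exists D.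
- rewrite inE; apply/negP => /minsetp /dominatingTP /(_ x).
  by rewrite inE => /(_ isT) [u]; rewrite inE.
- apply/forall_inP => A; rewrite inE => /minsetp domA.
  apply/forall_inP => B; rewrite inE => /minsetP[_ minB].
  apply/negP => ltAB; have eqAB := minB A domA (proper_sub ltAB).
  by rewrite eqAB properxx in ltAB.
Qed.

(* The non-neighbours of [x], with [x], dominate, and no dominating subset of
   them can omit [x]. *)
Lemma cover_min_dominating :
  (forall x : T, [set x] \notin E) ->
  cover (min_dominating_sets [set: T] E) = [set: T].
Proof.
move=> loopless; apply/setP => x; rewrite [RHS]inE.
pose D := [set y : T | [set x; y] \notin E].
have xD : x \in D by rewrite inE setUid loopless.
have domD : dominating [set: T] E D.
  by apply/dominatingTP => v; rewrite inE negbK; exists x.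
have [D' hD' sD'D] := min_dominating_sub domD.
apply/bigcupP; exists D' => //; apply/negPn/negP => xD'.
move: hD'; rewrite inE => /minsetp /dominatingTP /(_ x xD') [u uD' uxE].
by have := subsetP sD'D u uD'; rewrite inE setUC uxE.
Qed.

Lemma min_dominating_Dom r (x : T) :
  is_graph [set: T] E ->
  (forall D, #|D| = r -> dominating [set: T] E D) ->
  min_dominating_sets [set: T] E \in Dom r T.
Proof.
move=> graphE dom_r; rewrite inE; apply/and3P; split.
- rewrite /is_domination_hypergraph (min_dominating_hypergraph x) /=.
  apply/existsP; exists [set: T]; apply/existsP; exists E.
  by rewrite graphE eqxx.
- apply/eqP/cover_min_dominating => y; apply/negP => yE.
  by have /forall_inP/(_ _ yE) := graphE; rewrite cards1 andbF.
- by apply/hleP => A; rewrite inE => /eqP/dom_r/min_dominating_sub.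
Qed.

End MinimalDominatingSets.

Section StarComplement.

Variables (T : finType) (v : T) (B : {set T}).
Hypothesis vB : v \notin B.

(* The complete graph minus the edges from [v] to [B]. *)
Definition star_complement : {set {set T}} :=
  [set e : {set T} | (#|e| == 2) && ((v \in e) ==> [disjoint e & B])].

(** As [v] is outside [B], disjointness from [B] of a pair containing [v] constrains only its other
    end. *)
Lemma in_star_complement u w :
  ([set u; w] \in star_complement) =
  [&& u != w, (u == v) ==> (w \notin B) & (w == v) ==> (u \notin B)].
Proof.
rewrite inE cards2 eqSS eqb1 !inE; case: eqP => //= _.
rewrite -setI_eq0 setIUl setU_eq0 !setI_eq0 !disjoints1 ![v == _]eq_sym.
by case: (eqVneq u v) (eqVneq w v) => [->|_] [->|_] //=; rewrite ?vB ?andbT.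
Qed.

Lemma star_complement_graph : is_graph [set: T] star_complement.
Proof.
by apply/forall_inP => e; rewrite inE subsetT => /andP[].
Qed.

Lemma star_complement_dominating (D : {set T}) :
  #|B| < #|D| -> dominating [set: T] star_complement D.
Proof.
move=> ltBD; apply/dominatingTP => u uD.
(* The conditional lists the vertices other than [u] not adjacent to [u]. There are at most [#|B|]
   of them, also when the list is [[set v]], since then [u] lies in [B]. So [D] is too large to fit
   inside. *)
have [w wD hw] : exists2 w, w \in D &
    w \notin (if u == v then B else if u \in B then [set v] else set0).
  apply/subsetPn/negP => /subset_leq_card; rewrite leqNgt => /negP; apply.
  apply: leq_ltn_trans ltBD; case: ifP => // _; case: ifP => [uB|_].
    by rewrite cards1; apply/card_gt0P; exists u.
  by rewrite cards0.
exists w => //; rewrite in_star_complement (memPn uD) //=.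
move: hw; case: (eqVneq u v) => [-> wB|_]; first by rewrite wB vB implybT.
by case: (u \in B); rewrite !inE ?andbT ?implybT // => /negPf ->.
Qed.

Lemma star_complement_not_dominating :
  ~~ dominating [set: T] star_complement B.
Proof.
apply/negP => /dominatingTP /(_ v vB) [u uB].
by rewrite in_star_complement eqxx uB !andbF.
Qed.

(** Supersets of dominating sets dominate, so [A] inside [B] would make [B] dominating. *)
Lemma star_complement_avoid (A : {set T}) :
  A \in min_dominating_sets [set: T] star_complement -> ~~ (A \subset B).
Proof.
rewrite inE => /minsetp /dominatingTP domA; apply/negP => sAB.
have /negP := star_complement_not_dominating; apply; apply/dominatingTP => u uB.
have [|w wA wuE] := domA u; first by apply: contra uB; apply: subsetP.
by exists w => //; apply: (subsetP sAB).
Qed.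

End StarComplement.

Lemma min_completion_avoid (T : finType) (r : nat) (B : {set T}) :
  #|B| < r <= #|T| ->
  exists2 H, H \in min_completions r T & forall A, A \in H -> ~~ (A \subset B).
Proof.
case/andP=> ltBr lerT.
have [v _ vB] : exists2 v, v \in [set: T] & v \notin B.
  apply/subsetPn/negP => /subset_leq_card.
  by rewrite cardsT leqNgt (leq_trans ltBr lerT).
have [|H hH /hleP leH] := @min_completion_below _ r
    (min_dominating_sets [set: T] (star_complement v B)).
  apply: (min_dominating_Dom v); first exact: star_complement_graph.
  by move=> D cardD; apply: star_complement_dominating; rewrite ?cardD.
(* A member of [H] inside [B] would contain a minimal dominating set [A'], which would then lie
   inside [B] too. *)
exists H => // A /leH [A' /(star_complement_avoid vB) nA'B sA'A].
by apply: contra nA'B; apply: subset_trans.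
Qed.

Lemma exists_subset_card (T : finType) (A : {set T}) (k : nat) :
  k <= #|A| -> exists2 B : {set T}, B \subset A & #|B| = k.
Proof.
case/card_geqP=> s [uniq_s size_s sub_s]; exists [set x in s].
  by apply/subsetP => x; rewrite inE => /sub_s.
by rewrite cardsE (card_uniqP uniq_s).
Qed.

Section ChoiceUnions.

Variables (T : finType) (r : nat).
Hypothesis le_rT : r <= #|T|.

Let choice_union := is_choice_union (min_completions r T) id.

(** If [#|A| < r], some completion has no member inside [A], yet the union [A] contains the member
    chosen from it. *)
Lemma choice_union_card (A : {set T}) : choice_union A -> r <= #|A|.
Proof.
case/existsP=> f /andP[/forall_inP fH /eqP defA].
rewrite leqNgt; apply/negP => ltAr.
have [|H hH avoid] := @min_completion_avoid T r A; first by rewrite ltAr.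
by have /negP := avoid _ (fH H hH); apply; rewrite defA; apply: bigcup_sup.
Qed.

Lemma uniform_choice_union (A : {set T}) : #|A| = r -> choice_union A.
Proof.
move=> cardA.
(* The default [set0] is never taken on a completion, which has a member inside every [r]-set. *)
pose f := [ffun H : {set {set T}} => odflt set0 [pick B in H | B \subset A]].
have fP H : H \in min_completions r T -> (f H \in H) && (f H \subset A).
  rewrite !inE ffunE => /andP[/and3P[_ _ /hleP le_rH] _].
  have [|B hB sBA] := le_rH A; first by rewrite inE cardA.
  by case: pickP => //= /(_ B); rewrite hB sBA.
have cu : choice_union (\bigcup_(H in min_completions r T) f H).
  apply/existsP; exists f; rewrite eqxx andbT.
  by apply/forall_inP => H /fP /andP[].
(* The union lies inside [A] and, as a choice union, has at least [r] elements, so it fills [A]. *)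
suff /eqP <- : \bigcup_(H in min_completions r T) f H == A by [].
rewrite eqEcard cardA choice_union_card // andbT.
by apply/bigcupsP => H /fP /andP[].
Qed.

End ChoiceUnions.

Theorem theorem3p6 (T : finType) (n r : nat) (hn : #|T| = n)
    (hr : 1 <= r <= n) :
  uniform r T = sqcap (min_completions r T) (fun H : {set {set T}} => H).
Proof.
have le_rT : r <= #|T| by rewrite hn; case/andP: hr.
apply/setP => A; rewrite !inE; apply/eqP/minsetP => [cardA | [cuA minA]].
  split=> [|B cuB sBA]; first exact: uniform_choice_union.
  by apply/eqP; rewrite eqEcard sBA cardA; apply: choice_union_card cuB.
(* Any [r]-subset of [A] is itself a choice union, so minimality of [A] makes it all of [A]. *)
have [B sBA cardB] := exists_subset_card (choice_union_card le_rT cuA).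
by rewrite -(minA B) //; apply: uniform_choice_union.
Qed.
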